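(* Let $N$ be a torsion-free finitely generated nilpotent group with a finite generating subset $S$, and let $i>0$. Then there exist a natural number $k$ and a constant $C>0$ such that $\|N_i^\varphi\|_S\le C(\|\varphi\|_S)^k$ for every $\varphi\in\mathrm{Aut}(N)$.
   Context: $\|g\|_S$ is word length; for $\varphi\in\mathrm{Aut}(N)$, $\|\varphi\|_S=\max_{s\in S}\|\varphi(s)\|_S$. For a finitely generated subgroup $H\le N$, $\|H\|_S=\min\{\max_{h\in X}\|h\|_S : X \text{ a finite generating subset of } H\}$. Lower central series: $\gamma_1(N)=N$, $\gamma_i(N)=[N,\gamma_{i-1}(N)]$. The $i$-th twisted centralizer is the subgroup $N_i^\varphi=\{x\in N: x\,\varphi(x)^{-1}\in\gamma_i(N)\}$. *)

(* Defs.v *)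
From mathcomp Require Import ssreflect ssrfun ssrbool eqtype ssrnat.
From mathcomp Require Import boolp.
From Stdlib Require Import List Reals.

Set Implicit Arguments.
Unset Strict Implicit.

Record group := Group {
  carrier :> Type;
  gmul : carrier -> carrier -> carrier;
  ginv : carrier -> carrier;
  gone : carrier;
  gmulA : forall x y z, gmul x (gmul y z) = gmul (gmul x y) z;
  gmul1 : forall x, gmul gone x = x;
  gmulV : forall x, gmul (ginv x) x = gone
}.

Section GroupDefs.
Variable G : group.

Fixpoint gpow (x : G) (n : nat) : G :=
  match n with 0 => gone G | S m => gmul x (gpow x m) end.

Inductive gen (A : G -> Prop) : G -> Prop :=
| gen_base x : A x -> gen A x
| gen_one : gen A (gone G)
| gen_mul x y : gen A x -> gen A y -> gen A (gmul x y)
| gen_inv x : gen A x -> gen A (ginv x).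

Definition comm (x y : G) : G := gmul (gmul (ginv x) (ginv y)) (gmul x y).

Definition commg (A B : G -> Prop) : G -> Prop :=
  gen (fun z => exists a b, A a /\ B b /\ z = comm a b).

(* lower central series, indexed as in the paper: gamma 1 = N,
   gamma (i+1) = [N, gamma i]; (gamma 0 is set to N as a harmless convention) *)
Fixpoint gamma (i : nat) : G -> Prop :=
  match i with
  | 0 => fun _ => True
  | S 0 => fun _ => True
  | S j => commg (fun _ => True) (gamma j)
  end.

Definition nilpotent : Prop := exists c, forall x, gamma c x -> x = gone G.

Definition torsion_free : Prop :=
  forall (x : G) n, 0 < n -> gpow x n = gone G -> x = gone G.

Definition generates (S : list G) : Prop := forall x, gen (fun s => In s S) x.

Fixpoint weval (w : list (bool * G)) : G :=
  match w with
  | nil => gone G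
  | (b, s) :: w' => gmul (if b then ginv s else s) (weval w')
  end.

Definition word_over (S : list G) (w : list (bool * G)) : Prop :=
  forall p, In p w -> In (snd p) S.

Definition has_word_of_length (S : list G) (g : G) (n : nat) : Prop :=
  exists w, word_over S w /\ length w = n /\ weval w = g.

(* word length ||g||_S : the least length of a word over S^{±1} representing g
   (0 by convention if g is not in the subgroup generated by S) *)
Definition wordlen (S : list G) (g : G) : nat :=
  match pselect (exists n, `[< has_word_of_length S g n >]) with
  | left H => ex_minn H
  | right _ => 0
  end.

Definition is_aut (phi : G -> G) : Prop :=
  (forall x y, phi (gmul x y) = gmul (phi x) (phi y)) /\
  (forall x y, phi x = phi y -> x = y) /\ (forall y, exists x, phi x = y).

Definition autnorm (S : list G) (phi : G -> G) : nat :=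
  fold_right Nat.max 0 (map (fun s => wordlen S (phi s)) S).

Definition twisted_centralizer (phi : G -> G) (i : nat) : G -> Prop :=
  fun x => gamma i (gmul x (ginv (phi x))).

Definition generates_subgroup (X : list G) (H : G -> Prop) : Prop :=
  forall x, gen (fun h => In h X) x <-> H x.

End GroupDefs.

(* Main.v *)
Require Import Defs.
From Stdlib Require Import List Reals.
From Stdlib Require Import ZArith Lia Lra Classical.
From mathcomp Require Import ssreflect ssrfun ssrbool.
From mathcomp Require ssrnat boolp.

(** Write δ(x) = x φ(x)^-1.  Refine the lower central series to a series with cyclic factors:
    if G = <H, t> with [N, G] <= H, then δ induces a homomorphism from N_G = {x | δ(x) in G} to
    the cyclic group G/H, with kernel N_H.  Generators of such a kernel can be written down from
    generators x_1, ..., x_m of N_G: iterated commutators of the x_j, together with lifts of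
    generators of the lattice {e | sum e_j a_j = 0 mod q}, where a_j is the residue of x_j.
    Once the gcd g of the a_j and q is divided out, the lattice is generated by the Koszul
    vectors, whose entries are at most max(|a_j|, |q|); so word lengths grow polynomially as long
    as the residues do.  For the latter one needs that G is at most polynomially distorted in N.
    This follows from the same construction, applied to the projection G -> G/H instead of δ:
    collecting a word of length n in the x_j that lies in the kernel rewrites it as a word of
    polynomial length in the kernel generators. *)

Set Implicit Arguments.
Unset Strict Implicit.
Local Set Bullet Behavior "Strict Subproofs".
Local Open Scope nat_scope.

Declare Scope grp_scope.
Local Open Scope grp_scope.
Local Notation "x ** y" := (gmul x y) (at level 40, left associativity) : grp_scope.
Local Notation "x ^-1" := (ginv x) (at level 1, left associativity, format "x ^-1") : grp_scope.

(** * Polynomially bounded functions *)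

Definition poly_bounded (p : nat -> nat) : Prop :=
  exists C k, forall n, p n <= C * (n + 1) ^ k.

Lemma poly_bounded_const c : poly_bounded (fun _ => c).
Proof. exists c, 0 => n; rewrite Nat.pow_0_r; lia. Qed.

Lemma poly_bounded_id : poly_bounded (fun n => n).
Proof. exists 1, 1 => n; rewrite Nat.pow_1_r; lia. Qed.

(** This is why [poly_bounded] uses the base [n + 1]: it is at least 1, so bounds of different
    degrees can be raised to a common one. *)
Lemma pow_succ_mono n k l : k <= l -> (n + 1) ^ k <= (n + 1) ^ l.
Proof. move=> h; apply: Nat.pow_le_mono_r; lia. Qed.

Lemma poly_bounded_add p q :
  poly_bounded p -> poly_bounded q -> poly_bounded (fun n => p n + q n).
Proof.
move=> [C [k hp]] [D [l hq]]; exists (C + D), (k + l) => n.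
have := hp n; have := hq n.
have := @pow_succ_mono n k (k + l) ltac:(lia).
have := @pow_succ_mono n l (k + l) ltac:(lia).
nia.
Qed.

Lemma poly_bounded_mul p q :
  poly_bounded p -> poly_bounded q -> poly_bounded (fun n => p n * q n).
Proof.
move=> [C [k hp]] [D [l hq]]; exists (C * D), (k + l) => n.
rewrite Nat.pow_add_r.
have := Nat.mul_le_mono _ _ _ _ (hp n) (hq n); nia.
Qed.

Lemma poly_bounded_pow p k : poly_bounded p -> poly_bounded (fun n => p n ^ k).
Proof.
move=> hp; elim: k => [|k IH]; first exact: (poly_bounded_const 1).
exact: (poly_bounded_mul hp IH).
Qed.

Lemma poly_bounded_comp p q :
  poly_bounded p -> poly_bounded q -> poly_bounded (fun n => p (q n)).
Proof.
move=> [C [k hp]] hq.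
have [D [l h]] : poly_bounded (fun n => C * (q n + 1) ^ k).
  apply: (poly_bounded_mul (poly_bounded_const C)).
  apply: (@poly_bounded_pow (fun n => q n + 1)).
  exact: (poly_bounded_add hq (poly_bounded_const 1)).
by exists D, l => n; apply: Nat.le_trans (hp _) (h n).
Qed.

Ltac poly_bounded := repeat first
  [ assumption | exact: poly_bounded_const | exact: poly_bounded_id
  | apply: poly_bounded_add | apply: poly_bounded_mul | apply: poly_bounded_pow
  | apply: poly_bounded_comp ].

(** * Elementary group identities *)

Section Groups.
Variable N : group.
Implicit Types (x y z g h : N) (A B : N -> Prop).
Local Notation one := (gone N).

Lemma gmulVr x : x ** x^-1 = one.
Proof.
rewrite -[LHS]gmul1 -{1}(gmulV x^-1) -gmulA (gmulA x^-1 x) gmulV gmul1.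
exact: gmulV.
Qed.

Lemma gmulr1 x : x ** one = x.
Proof. by rewrite -(gmulV x) gmulA gmulVr gmul1. Qed.

Lemma gmulKV x y : x^-1 ** (x ** y) = y.
Proof. by rewrite gmulA gmulV gmul1. Qed.

Lemma gmulVK x y : x ** (x^-1 ** y) = y.
Proof. by rewrite gmulA gmulVr gmul1. Qed.

Lemma gmulI x y z : x ** y = x ** z -> y = z.
Proof. by move=> e; rewrite -(gmulKV x y) e gmulKV. Qed.

Lemma ginvK x : x^-1^-1 = x.
Proof. by apply: (@gmulI x^-1); rewrite gmulVr gmulV. Qed.

Lemma ginvM x y : (x ** y)^-1 = y^-1 ** x^-1.
Proof.
by apply: (@gmulI (x ** y)); rewrite gmulVr -gmulA (gmulA y) gmulVr gmul1 gmulVr.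
Qed.

Lemma ginv1 : one^-1 = one.
Proof. by rewrite -[LHS]gmul1 gmulVr. Qed.

End Groups.

Lemma gassoc (N : group) (x y z : N) : (x ** y) ** z = x ** (y ** z).
Proof. by rewrite gmulA. Qed.

(* [group] decides equalities that hold in every group: the rewrite system computes reduced words. *)
Hint Rewrite gassoc gmul1 gmulr1 gmulV gmulVr gmulKV gmulVK ginvK ginvM ginv1 : grp.
Ltac group := rewrite /comm; autorewrite with grp; try reflexivity.

(** * Words and word length *)

Section WordLength.
Variable N : group.
Implicit Types (x y z g h : N) (A B : N -> Prop).
Local Notation one := (gone N).

(** The trivial element is allowed at every [n], so this means length at most [n]. Unlike [wordlen],
    it has no default value for elements outside the subgroup generated by [A]. *)
Inductive word_le A : nat -> N -> Prop :=
| word_le_one n : word_le A n one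
| word_le_mul n x g : A x -> word_le A n g -> word_le A (S n) (x ** g)
| word_le_div n x g : A x -> word_le A n g -> word_le A (S n) (x^-1 ** g).

Lemma word_le_mono A m n g : m <= n -> word_le A m g -> word_le A n g.
Proof.
move=> le hg; elim: hg n le => {m g} [m|m x g hx _ IH|m x g hx _ IH] [|n] le;
  try lia; try constructor => //; apply: IH; lia.
Qed.

Lemma word_le_base A x : A x -> word_le A 1 x.
Proof. by move=> hx; rewrite -(gmulr1 x); constructor => //; constructor. Qed.

Lemma word_leM A m n g h : word_le A m g -> word_le A n h -> word_le A (m + n) (g ** h).
Proof.
move=> hg hh; elim: hg => {m g} [m|m x g hx _ IH|m x g hx _ IH].
- rewrite gmul1; apply: word_le_mono hh; lia.
- by rewrite gassoc; constructor.
- by rewrite gassoc; constructor.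
Qed.

Lemma word_leV A m g : word_le A m g -> word_le A m g^-1.
Proof.
elim=> {m g} [m|m x g hx _ IH|m x g hx _ IH].
- by rewrite ginv1; constructor.
- rewrite ginvM; apply: (@word_le_mono _ (m + 1)); first lia.
  apply: word_leM IH _; rewrite -(gmulr1 x^-1); constructor => //; constructor.
- rewrite ginvM ginvK; apply: (@word_le_mono _ (m + 1)); first lia.
  by apply: word_leM IH _; exact: word_le_base.
Qed.

Lemma word_le_trans A B m n g :
  (forall x, A x -> word_le B n x) -> word_le A m g -> word_le B (m * n) g.
Proof.
move=> hAB; elim=> {m g} [m|m x g hx _ IH|m x g hx _ IH]; first by constructor.
- by apply: word_leM IH; exact: hAB.
- by apply: word_leM IH; apply: word_leV; exact: hAB.
Qed.

Lemma word_le_sub A B m g : (forall x, A x -> B x) -> word_le A m g -> word_le B m g.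
Proof. by move=> s; elim=> *; constructor; auto. Qed.

Lemma word_le_gen A m g : word_le A m g -> gen A g.
Proof.
elim=> {m g} [m|m x g hx _ IH|m x g hx _ IH]; first exact: gen_one.
- by apply: gen_mul IH; exact: gen_base.
- by apply: gen_mul IH; apply: gen_inv; exact: gen_base.
Qed.

Lemma gen_word_le A g : gen A g -> exists n, word_le A n g.
Proof.
elim=> {g} [x hx||x y _ [m hm] _ [n hn]|x _ [m hm]].
- by exists 1; exact: word_le_base.
- by exists 0; constructor.
- by exists (m + n); exact: word_leM.
- by exists m; exact: word_leV.
Qed.

Lemma word_le_has_word (T : list N) n g : word_le (fun s => In s T) n g ->
  exists m, m <= n /\ has_word_of_length T g m.
Proof.
elim=> {n g} [n|n x g hx _ [m [le [w [ok [lw <-]]]]]|n x g hx _ [m [le [w [ok [lw <-]]]]]].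
- by exists 0; split; first lia; exists nil; split => // p [].
- exists (S m); split; first lia; exists ((false, x) :: w); rewrite /= lw; split => //.
  by move=> p [<-|/ok].
- exists (S m); split; first lia; exists ((true, x) :: w); rewrite /= lw; split => //.
  by move=> p [<-|/ok].
Qed.

Lemma has_word_word_le (T : list N) n g :
  has_word_of_length T g n -> word_le (fun s => In s T) n g.
Proof.
move=> [w [ok [<- <-]]] {n g}; elim: w ok => [|[b s] w IH] ok /=; first by constructor.
have hs : In s T by exact: (ok (b, s) (or_introl erefl)).
have hw : word_over T w by move=> p hp; apply: ok; right.
by case: b {ok}; constructor => //; apply: IH.
Qed.

Lemma wordlen_le (T : list N) n g : word_le (fun s => In s T) n g -> wordlen T g <= n.
Proof.
move=> /word_le_has_word [m [le hm]]; rewrite /wordlen; case: boolp.pselect => [H|]; last lia.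
case: ssrnat.ex_minnP => k _ /(_ m) mink.
have /ssrnat.leP : is_true (ssrnat.leq k m) by apply: mink; exact: boolp.asboolT.
lia.
Qed.

Lemma word_le_wordlen (T : list N) g :
  generates T -> word_le (fun s => In s T) (wordlen T g) g.
Proof.
move=> hS; have [n /word_le_has_word [m [_ hm]]] := gen_word_le (hS g).
rewrite /wordlen; case: boolp.pselect => [H|[]]; last by exists m; exact: boolp.asboolT.
case: ssrnat.ex_minnP => k hk _; exact: (has_word_word_le (boolp.asboolW hk)).
Qed.

Lemma word_le_autnorm (T : list N) (phi : N -> N) s : generates T -> In s T ->
  word_le (fun s => In s T) (autnorm T phi) (phi s).
Proof.
move=> hS hs; apply: word_le_mono (word_le_wordlen (phi s) hS); rewrite /autnorm.
(* Only the list over which the maximum runs is generalized; word lengths remain over [T]. *)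
elim: {1 4}T hs => [[]|t l IH] /= [->|/IH h]; lia.
Qed.

End WordLength.

(** * Lower central series *)

Section LowerCentralSeries.
Variable N : group.
Implicit Types (x y z g h : N).

Lemma gen_sub (A B : N -> Prop) x : (forall x, A x -> B x) -> gen A x -> gen B x.
Proof.
move=> s; elim=> {x} [x hx||x y _ hx _ hy|x _ hx]; first by apply: gen_base; exact: s.
- exact: gen_one.
- exact: gen_mul.
- exact: gen_inv.
Qed.

Lemma gen_idem (A : N -> Prop) x : gen (gen A) x -> gen A x.
Proof.
elim=> {x} [x hx||x y _ hx _ hy|x _ hx] //; first exact: gen_one.
- exact: gen_mul.
- exact: gen_inv.
Qed.

Lemma gammaSS i : gamma (S (S i)) = commg (fun _ : N => True) (gamma (S i)).
Proof. by []. Qed.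

Lemma gamma_comm i x g : gamma i g -> gamma (S i) (comm x g).
Proof. by case: i => [|i] hg //; rewrite gammaSS; apply: gen_base; exists x, g. Qed.

Lemma gamma_gen i x : gen (gamma i) x -> gamma i x.
Proof. case: i => [|[|i]] //; exact: gen_idem. Qed.

Lemma gammaS_sub i x : gamma (S i) x -> gamma i x.
Proof.
elim: i x => [|[|i] IH] x //.
rewrite gammaSS gammaSS; apply: gen_sub => z [a [b [_ [hb ->]]]].
by exists a, b; split => //; split => //; exact: IH.
Qed.

Lemma gamma_antitone i j x : i <= j -> gamma j x -> gamma i x.
Proof.
move=> le; elim: le x => {j} [|j _ IH] x //; move=> /gammaS_sub; exact: IH.
Qed.

End LowerCentralSeries.

(** * Collection in nilpotent groups *)

Section Collection.
Variables (N : group) (c : nat).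
Hypothesis gamma_trivial : forall x : N, gamma (S c) x -> x = gone N.
Variable X : list N.
Implicit Types (x y z g h b : N).
Local Notation one := (gone N).

Definition symmetric_letters : list N := X ++ map (@ginv N) X.

(** Right-normed commutators of weight [n + 1]. Inverses count as letters, so that swapping two
    letters of a word never calls for a commutator identity with inverses. *)
Fixpoint iterated_comms (n : nat) : list N :=
  match n with
  | 0 => symmetric_letters
  | S n => flat_map (fun y => map (comm y) (iterated_comms n)) symmetric_letters
  end.

(** The index starts at 1: every element is a genuine commutator and dies in each abelian
    quotient. *)
Definition comm_basis : list N := flat_map iterated_comms (seq 1 c).

Lemma iterated_commsS n y b :
  In y symmetric_letters -> In b (iterated_comms n) -> In (comm y b) (iterated_comms (S n)).
Proof. by move=> hy hb; apply/in_flat_map; exists y; split => //; apply: in_map. Qed.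

Lemma iterated_comms_gamma n b : In b (iterated_comms n) -> gamma (S n) b.
Proof.
elim: n b => [|n IH] b //= /in_flat_map [y [_ /in_map_iff [z [<- hz]]]].
by apply: (@gamma_comm _ (S n)); exact: IH.
Qed.

Lemma iterated_comms_basis n b : 1 <= n <= c -> In b (iterated_comms n) -> In b comm_basis.
Proof. by move=> hn hb; apply/in_flat_map; exists n; split => //; apply/in_seq; lia. Qed.

Lemma length_flat_map_le (A B : Type) (f : A -> list B) (l : list A) k :
  (forall a, In a l -> length (f a) <= k) -> length (flat_map f l) <= length l * k.
Proof.
elim: l => [|a l IH] h //=; rewrite length_app.
have := h a (or_introl erefl); have := IH (fun a0 ha => h a0 (or_intror ha)); lia.
Qed.

Lemma length_iterated_comms n : length (iterated_comms n) <= (2 * length X) ^ S n.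
Proof.
have e : length symmetric_letters = 2 * length X.
  by rewrite /symmetric_letters length_app length_map; lia.
elim: n => [|n IH]; first by rewrite /= e; lia.
apply: Nat.le_trans (@length_flat_map_le _ _ _ _ ((2 * length X) ^ S n) _) _.
  by move=> x _; rewrite length_map.
by rewrite e (Nat.pow_succ_r' _ (S n)).
Qed.

Lemma length_comm_basis : length comm_basis <= c * (2 * length X + 1) ^ S c.
Proof.
apply: Nat.le_trans (@length_flat_map_le _ _ _ _ ((2 * length X + 1) ^ S c) _) _; last first.
  by rewrite length_seq.
move=> n /in_seq hn; apply: Nat.le_trans (length_iterated_comms n) _.
apply: (@Nat.le_trans _ ((2 * length X + 1) ^ S n)); first by apply: Nat.pow_le_mono_l; lia.
by apply: Nat.pow_le_mono_r; lia.
Qed.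

Local Notation over_X := (word_le (fun x => In x X)).
Local Notation over_B := (word_le (fun x => In x comm_basis)).

Lemma symmetric_letters_word_le y : In y symmetric_letters -> over_X 1 y.
Proof.
move=> h; case: (in_app_or _ _ _ h) => [hy|/in_map_iff [x [<- hx]]]; first exact: word_le_base.
by apply: word_leV; exact: word_le_base.
Qed.

Lemma iterated_comms_word_le n b : In b (iterated_comms n) -> over_X (4 ^ n) b.
Proof.
elim: n b => [|n IH] b; first exact: symmetric_letters_word_le.
move=> /in_flat_map [y [/symmetric_letters_word_le hy /in_map_iff [z [<- /IH hz]]]].
have le : 1 + 4 ^ n + (1 + 4 ^ n) <= 4 ^ S n.
  have := Nat.pow_nonzero 4 n ltac:(lia); rewrite Nat.pow_succ_r'; lia.
apply: word_le_mono le _; apply: word_leM; apply: word_leM => //; exact: word_leV.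
Qed.

Lemma comm_basis_word_le b : In b comm_basis -> over_X (4 ^ c) b.
Proof.
move=> /in_flat_map [n [/in_seq hn /iterated_comms_word_le]].
by apply: word_le_mono; apply: Nat.pow_le_mono_r; lia.
Qed.

(** Letters are positions in [X] rather than elements, so exponent sums make sense even if [X] has
    repetitions. *)
Definition letter (p : bool * nat) : N :=
  if fst p then (nth (snd p) X one)^-1 else nth (snd p) X one.

Definition eval (w : list (bool * nat)) : N := fold_right (fun p g => letter p ** g) one w.

Definition valid (w : list (bool * nat)) : Prop := forall p, In p w -> snd p < length X.

Definition flip (p : bool * nat) : bool * nat := (negb (fst p), snd p).

Lemma letter_flip p : letter (flip p) = (letter p)^-1.
Proof. by case: p => [[] j]; rewrite /letter /= ?ginvK. Qed.

Lemma eval_app u v : eval (u ++ v) = eval u ** eval v.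
Proof. by elim: u => [|p u IH] /=; rewrite ?gmul1 // IH gassoc. Qed.

Lemma letter_symmetric p : snd p < length X -> In (letter p) symmetric_letters.
Proof.
move=> lt; apply/in_or_app; case: p lt => [[] j] /= lt; last by left; exact: nth_In.
by right; apply: in_map; exact: nth_In.
Qed.

Lemma valid_cons p w : valid (p :: w) <-> snd p < length X /\ valid w.
Proof.
split=> [h|[hp hw] q [<-|/hw] //].
by split=> [|q hq]; apply: h; [left|right].
Qed.

Lemma valid_app u v : valid (u ++ v) <-> valid u /\ valid v.
Proof.
split=> [h|[hu hv] q hq]; last by case: (in_app_or _ _ _ hq) => [/hu|/hv].
by split=> q hq; apply: h; apply/in_or_app; [left|right].
Qed.

Lemma eval_word_le w : valid w -> over_X (length w) (eval w).
Proof.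
elim: w => [|p w IH] /=; first by constructor.
move=> /valid_cons [/letter_symmetric /symmetric_letters_word_le hp /IH hw].
exact: (word_leM hp hw).
Qed.

Lemma word_le_eval n g : over_X n g -> exists w, valid w /\ length w <= n /\ eval w = g.
Proof.
elim=> {n g} [n|n x g /(@In_nth _ _ _ one) [j [lt <-]] _ [w [vw [lw <-]]]|
  n x g /(@In_nth _ _ _ one) [j [lt <-]] _ [w [vw [lw <-]]]].
- by exists nil; split; [move=> p []|split => //=; lia].
- exists ((false, j) :: w); split; first by apply/valid_cons.
  by split => //=; lia.
- exists ((true, j) :: w); split; first by apply/valid_cons.
  by split => //=; lia.
Qed.

Definition letter_sum (p : bool * nat) (k : nat) : Z :=
  if Nat.eqb (snd p) k then (if fst p then -1 else 1)%Z else 0%Z.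

Definition exp_sum (w : list (bool * nat)) (k : nat) : Z :=
  fold_right (fun p s => (letter_sum p k + s)%Z) 0%Z w.

Lemma exp_sum_app u v k : exp_sum (u ++ v) k = (exp_sum u k + exp_sum v k)%Z.
Proof. elim: u => [|p u IH] //=; rewrite IH; lia. Qed.

Lemma letter_sum_flip p k : letter_sum (flip p) k = (- letter_sum p k)%Z.
Proof. by case: p => [[] j]; rewrite /letter_sum /=; case: Nat.eqb. Qed.

Lemma exp_sum_flip_In p w : exp_sum (p :: w) (snd p) = 0%Z -> In (flip p) w.
Proof.
(* The strengthened claim suits induction: a tail whose exponent sum has the sign opposite to [p]
   keeps that property when a letter other than [flip p] is removed. *)
suff h : (exp_sum w (snd p) * letter_sum p (snd p) < 0)%Z -> In (flip p) w.
  move=> e; apply: h; move: e; rewrite /letter_sum /= /letter_sum Nat.eqb_refl.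
  by move: (exp_sum w (snd p)) => e; case: (fst p); lia.
elim: w => [|q w IH]; first by rewrite /=; lia.
move=> lt; case: (classic (q = flip p)) => [|ne]; [by left|right; apply: IH].
move: lt ne; case: p => [b j]; case: q => [b' j'].
rewrite /= /letter_sum /flip /= Nat.eqb_refl; move: (exp_sum w j) => e.
case: (Nat.eqb_spec j' j) => [->|_]; last lia.
by case: b; case: b' => //; lia.
Qed.

Hypothesis c_pos : 0 < c.

(* y^-1 b y = b [y,b]^-1, and [y,b] lies one step deeper in the lower central series. *)
Lemma conj_iterated_comm d n b w : 1 <= n -> n + d = c ->
  In b (iterated_comms n) -> valid w ->
  over_B ((length w + 1) ^ d) ((eval w)^-1 ** b ** eval w).
Proof.
elim: d n b w => [|d IHd] n b w n1 e hb.
  have -> : b = one by apply: gamma_trivial; have := iterated_comms_gamma hb; rewrite -e Nat.add_0_r.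
  by move=> _; rewrite gmulr1 gmulV; constructor.
elim: w => [|p w IHw] vw.
  rewrite /= Nat.pow_1_l ginv1 gmul1 gmulr1; apply: word_le_base.
  by apply: iterated_comms_basis hb; lia.
have [/letter_symmetric hp /[dup] vw' /IHw {}IHw] := (proj1 (valid_cons _ _)) vw.
have hc := IHd (S n) (comm (letter p) b) w ltac:(lia) ltac:(lia)
  (iterated_commsS hp hb) vw'.
have -> : (eval (p :: w))^-1 ** b ** eval (p :: w) =
    (eval w)^-1 ** b ** eval w ** ((eval w)^-1 ** comm (letter p) b ** eval w)^-1.
  by rewrite /=; group.
(* With L the length of [w], the two factors cost (L+1)^(d+1) + (L+1)^d = (L+1)^d (L+2), which is at
   most (L+2)^(d+1). *)
apply: word_le_mono (word_leM IHw (word_leV hc)).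
rewrite !Nat.pow_succ_r' /=.
have := Nat.pow_le_mono_l (length w + 1) (S (length w + 1)) d ltac:(lia).
nia.
Qed.

(** The letter [p] is moved to the right through [u] until it meets its inverse. Each swap p q = q p
    [p,q] leaves a commutator, which is carried to the right end of the word and thereby conjugated
    by the tail; [conj_iterated_comm] bounds the result. *)
Lemma cancel_letters p u v : valid (p :: u ++ v) ->
  exists b, over_B (length u * (length u + length v + 2) ^ c) b /\
    eval (p :: u ++ flip p :: v) = eval (u ++ v) ** b.
Proof.
elim: u => [|q u IH] /valid_cons [vp vw].
  by exists one; split; [constructor|rewrite /= letter_flip; group].
have [vq vuv] := proj1 (valid_cons _ _) vw.
have [b [hb eb]] := IH (proj2 (valid_cons _ _) (conj vp vuv)).
have vt : valid (u ++ flip p :: v).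
  by move/valid_app: vuv => [vu vv]; apply/valid_app; split => //; apply/valid_cons.
have hz : In (comm (letter p) (letter q)) (iterated_comms 1).
  by apply: iterated_commsS; exact: letter_symmetric.
have hc := @conj_iterated_comm (c - 1) 1 _ _ (le_n _) ltac:(lia) hz vt.
exists (b ** ((eval (u ++ flip p :: v))^-1 ** comm (letter p) (letter q)
  ** eval (u ++ flip p :: v))); split.
  apply: word_le_mono (word_leM hb hc); rewrite length_app /=.
  have h1 := Nat.pow_le_mono_l (length u + length v + 2) (S (length u + length v + 2)) c ltac:(lia).
  have := Nat.pow_le_mono_r (length u + S (length v) + 1) (c - 1) c ltac:(lia) ltac:(lia).
  have -> : length u + S (length v) + 1 = length u + length v + 2 by lia.
  nia.
have -> : eval (p :: (q :: u) ++ flip p :: v) = letter q ** eval (p :: u ++ flip p :: v)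
  ** ((eval (u ++ flip p :: v))^-1 ** comm (letter p) (letter q) ** eval (u ++ flip p :: v)).
  by rewrite /=; group.
by rewrite eb /=; group.
Qed.

(** The first letter has an inverse further on; cancelling the pair shortens the word by two, keeps
    all exponent sums zero and costs polynomially many elements of [comm_basis]. Hence the induction
    on a bound for the length. *)
Lemma eval_exp_sum0 w : valid w -> (forall k, exp_sum w k = 0%Z) ->
  over_B (length w * (length w * (length w + 1) ^ c)) (eval w).
Proof.
move: {2}(length w) (le_n (length w)) => n; elim: n w => [|n IH] [|p w] /= le vw e0;
  try lia; try by constructor.
have [u [v ew]] := in_split _ _ (@exp_sum_flip_In p w (e0 (snd p))).
have [vp vuv] : snd p < length X /\ valid (u ++ v).
  move: vw; rewrite ew => /valid_cons [hp /valid_app [hu /valid_cons [_ hv]]].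
  by split => //; apply/valid_app.
have [b [hb eb]] := cancel_letters (proj2 (valid_cons _ _) (conj vp vuv)).
have lw : length w = S (length (u ++ v)) by rewrite ew !length_app /=; lia.
have hw := IH (u ++ v) ltac:(lia) vuv _.
have -> : letter p ** eval w = eval (u ++ v) ** b by rewrite -eb ew.
apply: word_le_mono (word_leM (hw _) hb).
  rewrite lw length_app; set n1 := length u + length v.
  have h1 := Nat.pow_le_mono_l (n1 + 1) (S (S n1) + 1) c ltac:(lia).
  have h2 := Nat.pow_le_mono_l (n1 + 2) (S (S n1) + 1) c ltac:(lia).
  have h3 : length u <= n1 by rewrite /n1; lia.
  move: ((n1 + 1) ^ c) ((n1 + 2) ^ c) ((S (S n1) + 1) ^ c) h1 h2 => a a' d h1 h2.
  have := Nat.mul_le_mono_l _ _ (n1 * n1) h1; have := Nat.mul_le_mono _ _ _ _ h3 h2; lia.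
move=> k; have := e0 k; rewrite ew !exp_sum_app /= letter_sum_flip; lia.
Qed.

End Collection.

(** * Integer combinations and Koszul vectors *)

Section IntegerSums.
Local Open Scope Z_scope.
Implicit Types (f : nat -> Z).

Fixpoint zsum (m : nat) f : Z :=
  match m with O => 0 | S m => zsum m f + f m end.

Definition delta (i k : nat) : Z := if Nat.eqb i k then 1 else 0.

Lemma eq_zsum m f h : (forall k, (k < m)%nat -> f k = h k) -> zsum m f = zsum m h.
Proof.
elim: m => [|m IH] e //=; rewrite e; last lia.
by rewrite IH // => k lt; apply: e; lia.
Qed.

Lemma zsum_add m f h : zsum m (fun k => f k + h k) = zsum m f + zsum m h.
Proof. by elim: m => [|m IH] //=; rewrite IH; lia. Qed.

Lemma zsum_mull m z f : zsum m (fun k => z * f k) = z * zsum m f.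
Proof. by elim: m => [|m IH] /=; rewrite ?IH; lia. Qed.

Lemma zsum_mulr m z f : zsum m (fun k => f k * z) = zsum m f * z.
Proof. by elim: m => [|m IH] /=; rewrite ?IH; lia. Qed.

Lemma deltaC i k : delta i k = delta k i.
Proof. by rewrite /delta Nat.eqb_sym. Qed.

Lemma zsum_delta m i f : zsum m (fun k => delta i k * f k) = if Nat.ltb i m then f i else 0.
Proof.
elim: m => [|m IH] //; rewrite [LHS]/= IH /delta.
case: (Nat.ltb_spec i m); case: (Nat.ltb_spec i (S m)); case: (Nat.eqb_spec i m) => [->|];
  try lia.
Qed.

Lemma zsum_abs_le m f B : (forall k, (k < m)%nat -> Z.abs (f k) <= B) ->
  Z.abs (zsum m f) <= Z.of_nat m * B.
Proof.
elim: m => [|m IH] h; first by rewrite /=; lia.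
have := h m ltac:(lia); have := IH (fun k lt => h k ltac:(lia)).
rewrite [zsum (S m) f]/=; lia.
Qed.

Lemma abs_bound m f : exists B : nat, forall k, (k < m)%nat -> Z.abs (f k) <= Z.of_nat B.
Proof.
elim: m => [|m [B IH]]; first by exists O; lia.
exists (B + Z.abs_nat (f m))%nat => k lt.
case: (Nat.eq_dec k m) => [->|ne]; first lia.
have := IH k ltac:(lia); lia.
Qed.

(** Induction on [m], starting with g = q and merging one [a m] at a time by Bezout. Cofactors are
    returned instead of divisibilities, so nothing has to be divided when g = 0. *)
Lemma bezout_family m (a : nat -> Z) q : exists g alpha kappa u u0,
  (forall j, (j < m)%nat -> a j = g * alpha j) /\ q = g * kappa /\
  zsum m (fun j => u j * a j) + u0 * q = g.
Proof.
elim: m => [|m [g [alpha [kappa [u [u0 [ea [eq eg]]]]]]]].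
  by exists q, (fun _ => 0), 1, (fun _ => 0), 1; split; [lia|split; [ring|rewrite [zsum _ _]/=; ring]].
have [x [y exy]] := Z.gcd_bezout g (a m) _ erefl.
have [r er] := Z.gcd_divide_l g (a m); have [s es] := Z.gcd_divide_r g (a m).
move: (Z.gcd g (a m)) exy er es => d exy er es.
exists d, (fun j => if Nat.eqb j m then s else r * alpha j), (r * kappa),
  (fun j => if Nat.eqb j m then y else x * u j), (x * u0); split; [|split].
- move=> j lt; case: (Nat.eqb_spec j m) => [->|ne]; first lia.
  rewrite ea; last lia. rewrite er; ring.
- rewrite eq er; ring.
- rewrite [zsum _ _]/= Nat.eqb_refl (@eq_zsum _ _ (fun j => x * (u j * a j))).
    rewrite zsum_mull -exy -eg; ring.
  move=> k lt; case: (Nat.eqb_spec k m) => [|_]; [lia|ring].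
Qed.

End IntegerSums.

(** * Exponent vectors of words and generators of kernels *)

Section Kernel.
Variables (N : group) (c : nat).
Variable X : list N.
Implicit Types (x y g : N).
Local Notation one := (gone N).
Local Notation m := (length X).
Local Notation over_X := (word_le (fun x => In x X)).

Lemma exp_sum_out w k : valid X w -> m <= k -> exp_sum w k = 0%Z.
Proof.
move=> vw le; elim: w vw => [|p w IH] //= /valid_cons [vp /IH ->].
rewrite /letter_sum; case: Nat.eqb_spec => [e|//]; lia.
Qed.

Lemma exp_sum_abs_le w k : (Z.abs (exp_sum w k) <= Z.of_nat (length w))%Z.
Proof.
elim: w => [|p w IH]; first by rewrite /=; lia.
rewrite [exp_sum _ _]/= [length _]/= /letter_sum.
by move: (exp_sum w k) IH => e IH; case: Nat.eqb; case: (fst p); lia.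
Qed.

Definition inv_word (w : list (bool * nat)) := rev (map flip w).

Lemma eval_inv_word w : eval X (inv_word w) = (eval X w)^-1.
Proof.
elim: w => [|p w IH] /=; first by rewrite ginv1.
by rewrite /inv_word /= eval_app IH /= letter_flip gmulr1 ginvM.
Qed.

Lemma exp_sum_inv_word w k : exp_sum (inv_word w) k = (- exp_sum w k)%Z.
Proof.
elim: w => [|p w IH] //=.
rewrite /inv_word /= exp_sum_app IH /= letter_sum_flip; lia.
Qed.

Lemma length_inv_word w : length (inv_word w) = length w.
Proof. by rewrite /inv_word length_rev length_map. Qed.

Lemma valid_inv_word w : valid X w -> valid X (inv_word w).
Proof. by move=> vw p /in_rev; rewrite rev_involutive => /in_map_iff [q [<- /vw]]. Qed.

Definition power_word (j : nat) (z : Z) : list (bool * nat) :=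
  repeat (Z.ltb z 0, j) (Z.abs_nat z).

Lemma valid_power_word j z : j < m -> valid X (power_word j z).
Proof. by move=> lt p /(@repeat_spec _ _ _ _) ->. Qed.

Lemma exp_sum_power_word j z k : exp_sum (power_word j z) k = (z * delta j k)%Z.
Proof.
have h b n : exp_sum (repeat (b, j) n) k =
    ((if b then -1 else 1) * Z.of_nat n * delta j k)%Z.
  elim: n => [|n IH]; first by rewrite [exp_sum _ _]/=; lia.
  rewrite [exp_sum _ _]/= IH /letter_sum /delta /=; case: Nat.eqb; case: b {IH}; lia.
rewrite h; case: (Z.ltb_spec z 0) => lt; congr (_ * _)%Z; lia.
Qed.

Section Combinations.
Variable Y : list N.

(** Two lengths of one element are tracked: [n] counts generators from [Y] and enters the final
    bound, while [l] counts letters from [X] and controls the cost of collecting the difference from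
    another word with the same exponents. *)
Definition combination (e : nat -> Z) (n l : nat) : Prop :=
  exists w, valid X w /\ length w <= l /\ word_le (fun y => In y Y) n (eval X w) /\
    forall k, k < m -> exp_sum w k = e k.

Lemma combination_base w l : valid X w -> length w <= l -> In (eval X w) Y ->
  combination (exp_sum w) 1 l.
Proof. by move=> vw le hw; exists w; do !split => //; exact: word_le_base. Qed.

Lemma combination0 n l : combination (fun _ => 0%Z) n l.
Proof. by exists nil; split; [move=> p []|split=> /=; [lia|split; [constructor|]]]. Qed.

Lemma combination_ext e f n l n' l' : combination e n l -> n <= n' -> l <= l' ->
  (forall k, k < m -> e k = f k) -> combination f n' l'.
Proof.
move=> [w [vw [lw [hw ew]]]] ln ll ef; exists w; split => //; split; first lia.
by split => [|k lt]; [apply: word_le_mono hw|rewrite ew // ef].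
Qed.

Lemma combinationD e f n l n' l' : combination e n l -> combination f n' l' ->
  combination (fun k => e k + f k)%Z (n + n') (l + l').
Proof.
move=> [w [vw [lw [hw ew]]]] [w' [vw' [lw' [hw' ew']]]]; exists (w ++ w').
split; first by apply/valid_app.
split; first by rewrite length_app; lia.
split; first by rewrite eval_app; exact: word_leM.
by move=> k lt; rewrite exp_sum_app ew // ew'.
Qed.

Lemma combinationN e n l : combination e n l -> combination (fun k => - e k)%Z n l.
Proof.
move=> [w [vw [lw [hw ew]]]]; exists (inv_word w); split; first exact: valid_inv_word.
split; first by rewrite length_inv_word.
split; first by rewrite eval_inv_word; exact: word_leV.
by move=> k lt; rewrite exp_sum_inv_word ew.
Qed.

Lemma combinationZ e n l z r : combination e n l -> (Z.abs z <= Z.of_nat r)%Z ->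
  combination (fun k => z * e k)%Z (r * n) (r * l).
Proof.
move=> he.
have hnat t : combination (fun k => Z.of_nat t * e k)%Z (t * n) (t * l).
  elim: t => [|t IH]; first exact: combination0.
  apply: (combination_ext (combinationD he IH)); [lia|lia|move=> k _; lia].
case: (Z_le_gt_dec 0 z) => hz hr.
- apply: (combination_ext (hnat (Z.to_nat z))); [nia|nia|move=> k _].
  by rewrite Z2Nat.id.
- apply: (combination_ext (combinationN (hnat (Z.to_nat (- z))))); [nia|nia|move=> k _].
  by rewrite Z2Nat.id; lia.
Qed.

Lemma combination_zsum (e : nat -> nat -> Z) n l t :
  (forall j, j < t -> combination (e j) n l) ->
  combination (fun k => zsum t (fun j => e j k)) (t * n) (t * l).
Proof.
elim: t => [|t IH] h; first exact: combination0.
have ht := combinationD (IH (fun j lt => h j ltac:(lia))) (h t ltac:(lia)).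
by apply: (combination_ext ht); [lia|lia|].
Qed.

End Combinations.

(* For coprime integers alpha_1, ..., alpha_m, kappa, the Koszul vectors
   alpha_i eps_j - alpha_j eps_i and the kappa eps_k generate
   {e | sum e_k alpha_k = 0 mod kappa}. *)
Definition koszul_word (alpha : nat -> Z) (i j : nat) : list (bool * nat) :=
  power_word j (alpha i) ++ power_word i (- alpha j).

Definition kernel_generators (alpha : nat -> Z) (kappa : Z) : list N :=
  comm_basis c X ++
  flat_map (fun i => map (fun j => eval X (koszul_word alpha i j)) (seq 0 m)) (seq 0 m) ++
  map (fun k => eval X (power_word k kappa)) (seq 0 m).

(** Depends only on [c] and the number of generators, not on the residues; the three terms count
    commutators, Koszul vectors and multiples of unit vectors. *)
Definition kernel_rank (m : nat) : nat := c * (2 * m + 1) ^ S c + (m * m + m).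

Lemma length_kernel_generators alpha kappa :
  length (kernel_generators alpha kappa) <= kernel_rank m.
Proof.
rewrite /kernel_generators !length_app length_map length_seq.
apply: Nat.add_le_mono; first exact: length_comm_basis.
apply: Nat.add_le_mono; last exact: le_n.
rewrite -{3}(length_seq m 0).
by apply: length_flat_map_le => i _; rewrite length_map length_seq.
Qed.

Lemma valid_koszul_word alpha i j : i < m -> j < m -> valid X (koszul_word alpha i j).
Proof. by move=> hi hj; apply/valid_app; split; exact: valid_power_word. Qed.

Lemma exp_sum_koszul_word alpha i j k :
  exp_sum (koszul_word alpha i j) k = (alpha i * delta j k - alpha j * delta i k)%Z.
Proof. by rewrite exp_sum_app !exp_sum_power_word; lia. Qed.

Lemma length_koszul_word alpha i j (M : nat) :
  (Z.abs (alpha i) <= Z.of_nat M)%Z -> (Z.abs (alpha j) <= Z.of_nat M)%Z ->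
  length (koszul_word alpha i j) <= 2 * M.
Proof. by move=> hi hj; rewrite length_app !repeat_length; lia. Qed.

Lemma kernel_generatorsP alpha kappa y : In y (kernel_generators alpha kappa) <->
  In y (comm_basis c X) \/
  (exists i j, i < m /\ j < m /\ y = eval X (koszul_word alpha i j)) \/
  (exists k, k < m /\ y = eval X (power_word k kappa)).
Proof.
rewrite /kernel_generators !in_app_iff in_flat_map in_map_iff; split.
- case=> [h|[[i [/in_seq hi /in_map_iff [j [<- /in_seq hj]]]]|[k [<- /in_seq hk]]]].
  + by left.
  + by right; left; exists i, j; do !split => //; lia.
  + by right; right; exists k; split => //; lia.
- case=> [h|[[i [j [hi [hj ->]]]]|[k [hk ->]]]]; first by left.
  + right; left; exists i; split; first by apply/in_seq; lia.
    by apply/in_map_iff; exists j; split => //; apply/in_seq; lia.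
  + by right; right; exists k; split => //; apply/in_seq; lia.
Qed.

(** With eps_i the unit vectors, e = sum_{i,j} u_i e_j (alpha_i eps_j - alpha_j eps_i) + sum_i (u0
    e_i + u_i s) kappa eps_i. The double sum equals (sum_i u_i alpha_i) e - kappa s sum_i u_i eps_i;
    the second sum adds u0 kappa e and cancels the error, and the Bezout relation finishes. *)
Lemma koszul_decomposition alpha kappa u u0 (U M n : nat) (e : nat -> Z) s :
  (zsum m (fun j => u j * alpha j) + u0 * kappa = 1)%Z ->
  (zsum m (fun j => e j * alpha j) = kappa * s)%Z ->
  (forall j, (j < m)%nat -> Z.abs (alpha j) <= Z.of_nat M)%Z -> (Z.abs kappa <= Z.of_nat M)%Z ->
  (forall j, (j < m)%nat -> Z.abs (u j) <= Z.of_nat U)%Z -> (Z.abs u0 <= Z.of_nat U)%Z ->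
  (forall j, (j < m)%nat -> Z.abs (e j) <= Z.of_nat n)%Z -> (Z.abs s <= Z.of_nat (m * (n * M)))%Z ->
  let r := U * n + U * (m * (n * M)) in
  combination (kernel_generators alpha kappa) e
    (m * (m * (U * n)) + m * r) (m * (m * (U * n * (2 * M))) + m * (r * M)).
Proof.
move=> bez es hal hka hu hu0 he hs r.
have hij i j : i < m -> j < m -> combination (kernel_generators alpha kappa)
    (fun k => u i * e j * (alpha i * delta j k - alpha j * delta i k))%Z
    (U * n) (U * n * (2 * M)).
  move=> hi hj.
  have hw : combination (kernel_generators alpha kappa)
      (exp_sum (koszul_word alpha i j)) 1 (2 * M).
    apply: combination_base; first exact: valid_koszul_word.
      by apply: length_koszul_word; exact: hal.
    by apply/kernel_generatorsP; right; left; exists i, j.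
  have hue : (Z.abs (u i * e j) <= Z.of_nat (U * n))%Z.
    by rewrite Z.abs_mul Nat2Z.inj_mul; apply: Z.mul_le_mono_nonneg; auto; lia.
  apply: (combination_ext (combinationZ hw hue)); [lia|lia|move=> k _].
  by rewrite exp_sum_koszul_word.
have hk i : i < m -> combination (kernel_generators alpha kappa)
    (fun k => (u0 * e i + u i * s) * (kappa * delta i k))%Z r (r * M).
  move=> hi.
  have hw : combination (kernel_generators alpha kappa) (exp_sum (power_word i kappa)) 1 M.
    apply: combination_base; first exact: valid_power_word.
      by rewrite repeat_length; lia.
    by apply/kernel_generatorsP; right; right; exists i.
  have hr : (Z.abs (u0 * e i + u i * s) <= Z.of_nat r)%Z.
    have h1 : (Z.abs (u0 * e i) <= Z.of_nat (U * n))%Z.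
      by rewrite Z.abs_mul Nat2Z.inj_mul; apply: Z.mul_le_mono_nonneg; auto; lia.
    have h2 : (Z.abs (u i * s) <= Z.of_nat (U * (m * (n * M))))%Z.
      by rewrite Z.abs_mul Nat2Z.inj_mul; apply: Z.mul_le_mono_nonneg; auto; lia.
    by rewrite /r; lia.
  apply: (combination_ext (combinationZ hw hr)); [lia|lia|move=> k _].
  by rewrite exp_sum_power_word.
apply: (combination_ext (combinationD
  (combination_zsum (fun i hi => combination_zsum (fun j hj => hij i j hi hj)))
  (combination_zsum hk))); [lia|lia|move=> k hkm].
have row i : zsum m (fun j => u i * e j * (alpha i * delta j k - alpha j * delta i k))%Z =
    (u i * alpha i * e k + delta k i * (- u i * (kappa * s)))%Z.
  transitivity (zsum m (fun j => delta k j * (u i * alpha i * e j) +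
      (- u i * delta i k) * (e j * alpha j)))%Z.
    by apply: eq_zsum => j _; rewrite (deltaC k j); ring.
  rewrite zsum_add zsum_delta zsum_mull es (proj2 (Nat.ltb_lt _ _) hkm) (deltaC k i); ring.
rewrite (eq_zsum (fun i _ => row i)) zsum_add zsum_mulr.
have col : zsum m (fun i => (u0 * e i + u i * s) * (kappa * delta i k))%Z =
    zsum m (fun i => delta k i * ((u0 * e i + u i * s) * kappa))%Z.
  by apply: eq_zsum => i _; rewrite (deltaC k i); ring.
rewrite col !zsum_delta (proj2 (Nat.ltb_lt _ _) hkm).
rewrite -[RHS]Z.mul_1_l -bez; ring.
Qed.

End Kernel.

(** * Kernels of homomorphisms to cyclic groups *)

(* The graph of a homomorphism from a subgroup of N to Z/qZ, with residues represented by
   all their integer lifts; it is total on a subgroup H and its kernel is {x | R x 0}. *)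
Record residue_relation (N : group) (R : N -> Z -> Prop) (q : Z) : Prop := {
  residueM : forall x y e f, R x e -> R y f -> R (gmul x y) (e + f)%Z;
  residueV : forall x e, R x e -> R (ginv x) (- e)%Z;
  residue1 : forall e, R (gone N) e <-> (q | e)%Z
}.

Section KernelGenerators.
Variables (N : group) (c : nat).
Hypothesis gamma_trivial : forall x : N, gamma (S c) x -> x = gone N.
Hypothesis c_pos : 0 < c.
Variables (X : list N) (R : N -> Z -> Prop) (q : Z).
Hypothesis hR : residue_relation R q.
Implicit Types (x y g : N).
Local Notation one := (gone N).
Local Notation m := (length X).
Local Notation over T := (word_le (fun x => In x T)).

Lemma residue_shift x e d : R x e -> (q | d)%Z -> R x (e + d)%Z.
Proof. by move=> hx /(residue1 hR) h1; have := residueM hR hx h1; rewrite gmulr1. Qed.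

Lemma residue_dvd_sub x e f : R x e -> R x f -> (q | e - f)%Z.
Proof.
by move=> he /(residueV hR) /(residueM hR he); rewrite gmulVr => /(residue1 hR).
Qed.

Lemma residue_eval (a : nat -> Z) w : (forall j, j < m -> R (nth j X one) (a j)) ->
  valid X w -> R (eval X w) (zsum m (fun k => exp_sum w k * a k)%Z).
Proof.
move=> ha; elim: w => [|p w IH].
  move=> _; rewrite (@eq_zsum _ _ (fun k => 0 * a k)%Z) // zsum_mull.
  by apply/(residue1 hR); exists 0%Z; lia.
move=> /valid_cons [vp /IH hw].
have hp : R (letter X p) (zsum m (fun k => letter_sum p k * a k)%Z).
  have -> : zsum m (fun k => letter_sum p k * a k)%Z = (if fst p then - a (snd p) else a (snd p))%Z.
    transitivity (zsum m (fun k => delta (snd p) k * ((if fst p then -1 else 1) * a k))%Z).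
      by apply: eq_zsum => k _; rewrite /letter_sum /delta; case: Nat.eqb; case: (fst p); lia.
    by rewrite zsum_delta (proj2 (Nat.ltb_lt _ _) vp); case: (fst p); lia.
  by rewrite /letter; case: (fst p); [apply: (residueV hR)|]; exact: ha.
have := residueM hR hp hw; rewrite -zsum_add.
by rewrite (@eq_zsum _ _ (fun k => exp_sum (p :: w) k * a k)%Z) // => k _ /=; lia.
Qed.

Lemma residue_comm x y e f : R x e -> R y f -> R (comm x y) 0.
Proof.
move=> hx hy; have -> : 0%Z = (- e + - f + (e + f))%Z by lia.
by do !apply: (residueM hR) => //; exact: (residueV hR).
Qed.

Lemma residue_comm_basis b : (forall x, In x X -> exists e, R x e) ->
  In b (comm_basis c X) -> R b 0.
Proof.
move=> hX /in_flat_map [n [/in_seq [n1 _]]].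
have hs y : In y (symmetric_letters X) -> exists e, R y e.
  move=> hy; case: (in_app_or _ _ _ hy) => [/hX //|/in_map_iff [x [<- /hX [e he]]]].
  by exists (- e)%Z; exact: (residueV hR).
have hn k y : In y (iterated_comms X k) -> exists e, R y e.
  elim: k y => [|k IH] y; first exact: hs.
  move=> /in_flat_map [z [/hs [e he] /in_map_iff [t [<- /IH [f hf]]]]].
  by exists 0%Z; exact: residue_comm he hf.
case: n n1 => [|n] n1; first lia.
move=> /in_flat_map [z [/hs [e he] /in_map_iff [t [<- /hn [f hf]]]]].
exact: residue_comm he hf.
Qed.

(** A word in the kernel is compared with a word of the same exponent sums built from the kernel
    generators; their quotient has zero exponent sums and is collected into [comm_basis]. The
    polynomial [p] may depend on the residues through the Bezout coefficients, whereas the number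
    and length of the generators have explicit bounds, as these must be uniform over
    automorphisms. *)
Lemma kernel_generated (a : nat -> Z) (M : nat) :
  (forall j, j < m -> R (nth j X one) (a j)) ->
  (forall j, j < m -> (Z.abs (a j) <= Z.of_nat M)%Z) -> (Z.abs q <= Z.of_nat M)%Z ->
  exists Y, [/\ forall y, In y Y -> R y 0,
    forall y, In y Y -> over X (4 ^ c + 2 * M + 1) y,
    length Y <= kernel_rank c m &
    exists p, poly_bounded p /\ forall n g, over X n g -> R g 0 -> over Y (p n) g].
Proof.
move=> ha haM hqM.
have [g [alpha [kappa [u [u0 [ea [eq bez]]]]]]] := bezout_family m a q.
(* If g = 0, all the [a j] vanish and [X] itself lies in the kernel. Otherwise g can be cancelled
   from the Bezout relation. *)
case: (Z.eq_dec g 0) => [g0|gn0].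
{ exists X; split.
  - move=> y /(@In_nth _ _ _ one) [j [lt <-]].
    by have := ha j lt; rewrite ea // g0.
  - by move=> y hy; apply: word_le_mono (word_le_base hy); lia.
  - by rewrite /kernel_rank; lia.
  - by exists id; split; [exact: poly_bounded_id|]. }
have hal j : j < m -> (Z.abs (alpha j) <= Z.of_nat M)%Z.
  move=> lt; have := haM j lt; rewrite (ea j lt) Z.abs_mul; nia.
have hka : (Z.abs kappa <= Z.of_nat M)%Z by move: hqM; rewrite eq Z.abs_mul; nia.
have {}bez : (zsum m (fun j => u j * alpha j) + u0 * kappa = 1)%Z.
  apply: (Z.mul_reg_l _ _ g) => //; rewrite Z.mul_1_r -{2}bez Z.mul_add_distr_l -zsum_mull.
  congr (_ + _)%Z; last by rewrite eq; ring.
  by apply: eq_zsum => j lt; rewrite ea //; ring.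
have [U0 hU0] := abs_bound m u; set U := U0 + Z.abs_nat u0.
have hU j : j < m -> (Z.abs (u j) <= Z.of_nat U)%Z by move=> /hU0; rewrite /U; lia.
(* Since q = g kappa, such a residue is a multiple of q. *)
have hkill x e : R x (g * kappa * e)%Z -> R x 0%Z.
  move=> hx; have := residue_shift hx (d := (- (g * kappa * e))%Z).
  by rewrite Z.add_opp_diag_r; apply; exists (- e)%Z; rewrite {1}eq; ring.
exists (kernel_generators c X alpha kappa); split.
- move=> y /kernel_generatorsP [hb|[[i [j [hi [hj ->]]]]|[k [hk ->]]]].
  + apply: residue_comm_basis hb => x /(@In_nth _ _ _ one) [j [lt <-]].
    by exists (a j); exact: ha.
  + have := residue_eval ha (valid_koszul_word (alpha:=alpha) hi hj).
    rewrite (@eq_zsum _ _ (fun k => delta j k * (alpha i * a k) +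
      delta i k * (- alpha j * a k))%Z); last first.
      by move=> k _; rewrite exp_sum_koszul_word; ring.
    rewrite zsum_add !zsum_delta !(proj2 (Nat.ltb_lt _ _)) // !ea //.
    by have -> : (alpha i * (g * alpha j) + - alpha j * (g * alpha i) = 0)%Z by ring.
  + have := residue_eval ha (valid_power_word (z:=kappa) hk).
    rewrite (@eq_zsum _ _ (fun j => delta k j * (kappa * a j))%Z); last first.
      by move=> j _; rewrite exp_sum_power_word; ring.
    rewrite zsum_delta (proj2 (Nat.ltb_lt _ _) hk) ea // => h.
    by apply: (hkill _ (alpha k)); have -> : (g * kappa * alpha k = kappa * (g * alpha k))%Z by ring.
- move=> y /kernel_generatorsP [hb|[[i [j [hi [hj ->]]]]|[k [hk ->]]]].
  + by apply: word_le_mono (comm_basis_word_le hb); lia.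
  + apply: word_le_mono (eval_word_le (valid_koszul_word (alpha:=alpha) hi hj)).
    have := length_koszul_word (hal i hi) (hal j hj); lia.
  + apply: word_le_mono (eval_word_le (valid_power_word (z:=kappa) hk)).
    by rewrite repeat_length; lia.
- exact: length_kernel_generators.
- pose r n := U * n + U * (m * (n * M)).
(* The length over [X] of the comparison word, plus [n] for the original word. *)
pose l n := m * (m * (U * n * (2 * M))) + m * (r n * M) + n.
exists (fun n => m * (m * (U * n)) + m * r n + l n * (l n * (l n + 1) ^ c)); split.
  by rewrite /l /r; poly_bounded.
move=> n x /word_le_eval [w [vw [lw <-]]] hx.
set E := zsum m (fun j => exp_sum w j * alpha j)%Z.
(* The quotient must be bounded by E; if kappa = 0 it is arbitrary, and 0 is chosen. *)
have [s [es hs]] : exists s, E = (kappa * s)%Z /\ (Z.abs s <= Z.abs E)%Z.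
  have := residue_dvd_sub (residue_eval ha vw) hx.
  rewrite Z.sub_0_r (@eq_zsum _ _ (fun j => g * (exp_sum w j * alpha j))%Z); last first.
    by move=> j lt; rewrite ea //; ring.
  rewrite zsum_mull -/E => [[t et]].
  have eE : E = (kappa * t)%Z by apply: (Z.mul_reg_l _ _ g) => //; rewrite et eq; ring.
  case: (Z.eq_dec kappa 0) => [k0|kn0].
    by exists 0%Z; rewrite eE k0; lia.
  by exists t; split => //; rewrite eE Z.abs_mul; nia.
have he j : j < m -> (Z.abs (exp_sum w j) <= Z.of_nat n)%Z.
  by move=> _; have := @exp_sum_abs_le w j; lia.
have hE : (Z.abs E <= Z.of_nat (m * (n * M)))%Z.
  rewrite Nat2Z.inj_mul; apply: zsum_abs_le => j lt.
  by rewrite Z.abs_mul Nat2Z.inj_mul; apply: Z.mul_le_mono_nonneg; auto; lia.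
have [w' [vw' [lw' [hw' ew']]]] := koszul_decomposition c bez es hal hka hU
  ltac:(rewrite /U; lia) he (Z.le_trans _ _ _ hs hE).
(* The quotient of the two words, with all exponent sums zero. *)
have v0 : valid X (inv_word w' ++ w) by apply/valid_app; split => //; exact: valid_inv_word.
have e0 k : exp_sum (inv_word w' ++ w) k = 0%Z.
  rewrite exp_sum_app exp_sum_inv_word; case: (Nat.lt_ge_cases k m) => hk.
    by rewrite ew' //; lia.
  by rewrite !(@exp_sum_out _ X).
have hB := eval_exp_sum0 gamma_trivial c_pos v0 e0.
have -> : eval X w = eval X w' ** eval X (inv_word w' ++ w).
  by rewrite eval_app eval_inv_word gmulVK.
apply: word_leM hw' _.
apply: (@word_le_sub _ (fun b => In b (comm_basis c X))).
  by move=> b hb; apply/kernel_generatorsP; left.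
apply: word_le_mono hB.
have le : length (inv_word w' ++ w) <= l n.
  by rewrite length_app length_inv_word /l /r; lia.
apply: Nat.mul_le_mono => //; apply: Nat.mul_le_mono => //.
apply: Nat.pow_le_mono_l; lia.
Qed.

End KernelGenerators.

(** * Finite choice and subgroups of the integers *)

Lemma finite_choice m (P : nat -> Z -> Prop) :
  (forall j, j < m -> exists e, P j e) -> exists a, forall j, j < m -> P j (a j).
Proof.
elim: m => [|m IH] h; first by exists (fun _ => 0%Z); lia.
have [a ha] := IH (fun j lt => h j ltac:(lia)); have [e he] := h m ltac:(lia).
exists (fun j => if Nat.eqb j m then e else a j) => j lt.
by case: (Nat.eqb_spec j m) => [->|ne] //; apply: ha; lia.
Qed.

Lemma Z_subgroup_principal (P : Z -> Prop) : P 0%Z ->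
  (forall e f, P e -> P f -> P (e + f)%Z) -> (forall e, P e -> P (- e)%Z) ->
  exists q, forall e, P e <-> (q | e)%Z.
Proof.
move=> P0 PD PN.
have PM q z : P q -> P (z * q)%Z.
  move=> hq; elim/Z.peano_ind: z => [|z IH|z IH] //.
    by rewrite Z.mul_succ_l; exact: PD.
  by rewrite Z.mul_pred_l; apply: PD => //; exact: PN.
case: (classic (exists n, 0 < n /\ P (Z.of_nat n))) => [ex|nex].
  have [q [[[q_pos Pq] qmin] _]] := dec_inh_nat_subset_has_unique_least_element
    _ (fun n => classic _) ex.
  exists (Z.of_nat q) => e; split=> [he|[z ->]]; last exact: PM.
  have em := Z.div_mod e (Z.of_nat q) ltac:(lia).
  have lt := Z.mod_pos_bound e (Z.of_nat q) ltac:(lia).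
  have hm : P (e mod Z.of_nat q)%Z.
    have -> : (e mod Z.of_nat q = e + (- (e / Z.of_nat q)) * Z.of_nat q)%Z by lia.
    by apply: PD => //; exact: PM.
  case: (Z.eq_dec (e mod Z.of_nat q) 0) => e0; first by exists (e / Z.of_nat q)%Z; lia.
  have := qmin (Z.to_nat (e mod Z.of_nat q)); rewrite Z2Nat.id; last lia.
  have r_pos : 0 < Z.to_nat (e mod Z.of_nat q) by lia.
  by move=> /(_ (conj r_pos hm)); lia.
exists 0%Z => e; split=> [he|[z ->]]; last by rewrite Z.mul_0_r.
exists 0%Z; case: (Z.lt_trichotomy e 0) => [lt|[//|lt]]; case: nex.
  by exists (Z.to_nat (- e)); split; [lia|rewrite Z2Nat.id; [exact: PN|lia]].
by exists (Z.to_nat e); split; [lia|rewrite Z2Nat.id; [|lia]].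
Qed.

(** * Integer powers *)

Section IntegerPowers.
Variable N : group.
Implicit Type t : N.

(** [Z.to_nat] sends negative integers to 0, so at least one factor is trivial. *)
Definition zpow t (e : Z) : N := gpow t (Z.to_nat e) ** (gpow t (Z.to_nat (- e)))^-1.

Lemma gpowSr t n : gpow t (S n) = gpow t n ** t.
Proof. by elim: n => [|n IH] /=; [group|rewrite gassoc -IH]. Qed.

Lemma zpow0 t : zpow t 0 = gone N.
Proof. by rewrite /zpow /=; group. Qed.

Lemma zpow_succ t e : zpow t (Z.succ e) = t ** zpow t e.
Proof.
rewrite /zpow; case: (Z_le_gt_dec 0 e) => h.
  have -> : Z.to_nat (Z.succ e) = S (Z.to_nat e) by lia.
  have -> : Z.to_nat (- Z.succ e) = 0 by lia.
  have -> : Z.to_nat (- e) = 0 by lia.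
  by rewrite /=; group.
have -> : Z.to_nat (Z.succ e) = 0 by lia.
have -> : Z.to_nat e = 0 by lia.
have -> : Z.to_nat (- e) = S (Z.to_nat (- Z.succ e)) by lia.
by rewrite gpowSr /=; group.
Qed.

Lemma zpowD t e f : zpow t (e + f) = zpow t e ** zpow t f.
Proof.
elim/Z.peano_ind: e => [|e IH|e IH]; first by rewrite zpow0 gmul1.
  by rewrite Z.add_succ_l !zpow_succ IH gassoc.
apply: (@gmulI _ t); rewrite -zpow_succ.
have -> : Z.succ (Z.pred e + f) = (e + f)%Z by lia.
by rewrite IH -gassoc -zpow_succ Z.succ_pred.
Qed.

Lemma zpowN t e : zpow t (- e) = (zpow t e)^-1.
Proof. by apply: (@gmulI _ (zpow t e)); rewrite -zpowD Z.add_opp_diag_r zpow0 gmulVr. Qed.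

End IntegerPowers.

(** * Automorphisms and their effect on word length *)

Section Automorphisms.
Variables (N : group) (phi : N -> N).
Hypothesis hphi : is_aut phi.

Lemma autM x y : phi (x ** y) = phi x ** phi y.
Proof. by case: hphi. Qed.

Lemma aut1 : phi (gone N) = gone N.
Proof. by apply: (@gmulI _ (phi (gone N))); rewrite -autM gmul1 gmulr1. Qed.

Lemma autV x : phi x^-1 = (phi x)^-1.
Proof. by apply: (@gmulI _ (phi x)); rewrite -autM !gmulVr aut1. Qed.

Lemma word_le_aut A m n g : (forall s, A s -> word_le A n (phi s)) ->
  word_le A m g -> word_le A (m * n) (phi g).
Proof.
move=> hA; elim=> {m g} [m|m x g hx _ IH|m x g hx _ IH]; first by rewrite aut1; constructor.
- by rewrite autM; apply: word_leM IH; exact: hA.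
- by rewrite autM autV; apply: word_leM IH; apply: word_leV; exact: hA.
Qed.

End Automorphisms.

(** * Descent along the lower central series *)

Section Descent.
Variables (N : group) (gens : list N).
Hypothesis hS : generates gens.
Implicit Types (G H : N -> Prop) (x y g : N).
Local Notation one := (gone N).
Local Notation over T := (word_le (fun x => In x T)).

(** Finite generation of [G] together with at most polynomial distortion in [N]. *)
Definition poly_distorted G : Prop :=
  exists T, (forall x, gen (fun t => In t T) x <-> G x) /\
    exists p, poly_bounded p /\ forall n g, G g -> over gens n g -> over T (p n) g.

(* The bound r on the number of generators must be uniform in phi for the induction to go through. *)
Definition poly_generated_twisted G : Prop :=
  exists r p, poly_bounded p /\ forall phi, is_aut phi -> exists X,
    [/\ length X <= r, forall x, gen (fun t => In t X) x <-> G (x ** (phi x)^-1) &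
      forall x, In x X -> over gens (p (autnorm gens phi)) x].

Variable c : nat.
Hypothesis gamma_trivial : forall x : N, gamma (S c) x -> x = one.
Hypothesis c_pos : 0 < c.

(** * One step from G = <H, t> down to H, where G/H is cyclic and central in N/H *)

Section CyclicStep.
Variables (H : N -> Prop) (t : N).
Hypotheses (H1 : H one) (HM : forall x y, H x -> H y -> H (x ** y))
  (HV : forall x, H x -> H x^-1).
Local Notation G := (gen (fun x => H x \/ x = t)).
Hypothesis H_comm : forall x g, G g -> H (comm x g).

Definition residue g (e : Z) : Prop := H (g ** zpow t (- e)).

Lemma H_sub g : H g -> G g.
Proof. by move=> hg; apply: gen_base; left. Qed.

Lemma H_conj x g : H g -> H (x ** g ** x^-1).
Proof.
move=> hg; have -> : x ** g ** x^-1 = comm x^-1 g^-1 ** g by group.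
by apply: HM => //; apply: H_comm; apply: gen_inv; exact: H_sub.
Qed.

Lemma residue0 g : residue g 0 <-> H g.
Proof. by rewrite /residue zpow0 gmulr1. Qed.

Lemma residue_mul g h e f : residue g e -> residue h f -> residue (g ** h) (e + f).
Proof.
rewrite /residue => hg hh.
have -> : (- (e + f) = - f + - e)%Z by lia.
have -> : g ** h ** zpow t (- f + - e) =
    g ** (h ** zpow t (- f)) ** g^-1 ** (g ** zpow t (- e)) by rewrite zpowD; group.
by apply: HM hg; exact: H_conj.
Qed.

Lemma residue_inv g e : residue g e -> residue g^-1 (- e).
Proof.
rewrite /residue => hg; have := H_conj g^-1 (HV hg).
by rewrite !zpowN; group.
Qed.

(** Centrality of G/H in N/H: here [x] ranges over all of [N]. *)
Lemma residue_conj x g e : G g -> residue g e -> residue (x ** g ** x^-1) e.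
Proof.
rewrite /residue => hG hg.
have -> : x ** g ** x^-1 ** zpow t (- e) = comm x^-1 g^-1 ** (g ** zpow t (- e)) by group.
by apply: HM hg; apply: H_comm; exact: gen_inv.
Qed.

Lemma residue_exists g : G g -> exists e, residue g e.
Proof.
elim=> {g} [x [hx| ->]||x y _ [e he] _ [f hf]|x _ [e he]].
- by exists 0%Z; apply/residue0.
- by exists 1%Z; rewrite /residue zpowN (zpow_succ t 0) zpow0 gmulr1 gmulVr.
- by exists 0%Z; apply/residue0.
- by exists (e + f)%Z; exact: residue_mul.
- by exists (- e)%Z; exact: residue_inv.
Qed.

(** The exponents e with t^e in H form a subgroup of the integers; [q] is a generator of it, up to
    sign the order of [t] modulo H, or 0 if that order is infinite. *)
Lemma residue_relation_exists : exists q, residue_relation residue q.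
Proof.
have [q hq] : exists q, forall e, residue one e <-> (q | e)%Z.
  apply: Z_subgroup_principal; first exact/residue0.
    by move=> e f he hf; have := residue_mul he hf; rewrite gmul1.
  by move=> e he; have := residue_inv he; rewrite ginv1.
by exists q; split => //; [exact: residue_mul|exact: residue_inv].
Qed.

Lemma residue_list_bound T : (forall x, In x T -> G x) ->
  exists a (A : nat), forall j, j < length T ->
    residue (nth j T one) (a j) /\ (Z.abs (a j) <= Z.of_nat A)%Z.
Proof.
move=> hT.
have [a ha] := @finite_choice (length T) (fun j e => residue (nth j T one) e)
  (fun j lt => residue_exists (hT _ (nth_In _ _ lt))).
have [A hA] := abs_bound (length T) a.
by exists a, A => j lt; split; auto.
Qed.

Lemma gen_kernel T (R : N -> Z -> Prop) q Y p x : residue_relation R q ->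
  (forall y, In y Y -> R y 0%Z) -> (forall n g, over T n g -> R g 0%Z -> over Y (p n) g) ->
  (R x 0%Z -> gen (fun t => In t T) x) ->
  gen (fun y => In y Y) x <-> R x 0%Z.
Proof.
move=> hR hY hp hT; split; last first.
  by move=> hx; have [n /hp h] := gen_word_le (hT hx); apply: word_le_gen (h hx).
elim=> {x hT} [x /hY //||x y _ hx _ hy|x _ hx].
- by apply/(residue1 hR); exists 0%Z.
- exact: (residueM hR hx hy).
- exact: (residueV hR hx).
Qed.

(** The residues of the fixed list [T] are constants, so rewriting first over [T] and then over the
    kernel generators composes two polynomials. *)
Lemma poly_distorted_step : poly_distorted G -> poly_distorted H.
Proof.
move=> [T [hT [p [hp pT]]]].
have [q hR] := residue_relation_exists.
have [a [A ha]] := residue_list_bound (fun x hx => proj1 (hT x) (gen_base hx)).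
have haR j (lt : j < length T) : residue (nth j T one) (a j) by have [] := ha j lt.
have haA j (lt : j < length T) : (Z.abs (a j) <= Z.of_nat (A + Z.abs_nat q))%Z.
  by have [_] := ha j lt; lia.
have [Y [Y0 _ _ [pY [hpY YT]]]] :=
  kernel_generated gamma_trivial c_pos hR haR haA ltac:(lia).
exists Y; split=> [x|].
  rewrite -residue0; apply: (gen_kernel hR Y0 YT) => /residue0 hx.
  by apply/hT; exact: H_sub.
exists (fun n => pY (p n)); split; first exact: poly_bounded_comp.
move=> n g hg hn; apply: YT; last exact/residue0.
by apply: pT hn; exact: H_sub.
Qed.

Lemma residue_word_bound T (a : nat -> Z) (A : nat) n g :
  (forall j, j < length T -> residue (nth j T one) (a j) /\ (Z.abs (a j) <= Z.of_nat A)%Z) ->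
  over T n g -> exists e, residue g e /\ (Z.abs e <= Z.of_nat (n * A))%Z.
Proof.
move=> ha; elim=> {n g} [n|n x g /(@In_nth _ _ _ one) [j [/ha [hj lj] <-]] _ [e [he le]]|
  n x g /(@In_nth _ _ _ one) [j [/ha [hj lj] <-]] _ [e [he le]]].
- by exists 0%Z; split; [apply/residue0|lia].
- by exists (a j + e)%Z; split; [exact: residue_mul|lia].
- by exists (- a j + e)%Z; split; [apply: residue_mul he; exact: residue_inv|lia].
Qed.

(* x |-> x phi(x)^-1 is a homomorphism modulo H on the subgroup {x | x phi(x)^-1 in G},
   because G is central modulo H. *)
Lemma twisted_residue_relation phi q : is_aut phi -> residue_relation residue q ->
  residue_relation (fun x e => G (x ** (phi x)^-1) /\ residue (x ** (phi x)^-1) e) q.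
Proof.
move=> hphi hR.
have GJ x g : G g -> G (x ** g ** x^-1).
  move=> hg; have -> : x ** g ** x^-1 = comm x^-1 g^-1 ** g by group.
  by apply: gen_mul (hg); apply: H_sub; apply: H_comm; exact: gen_inv.
split.
- move=> x y e f [gx hx] [gy hy].
  have -> : x ** y ** (phi (x ** y))^-1 = x ** (y ** (phi y)^-1) ** x^-1 ** (x ** (phi x)^-1).
    by rewrite (autM hphi); group.
  split; first by apply: gen_mul gx; exact: GJ.
  by rewrite Z.add_comm; apply: residue_mul hx; exact: residue_conj.
- move=> x e [gx hx].
  have -> : x^-1 ** (phi x^-1)^-1 = x^-1 ** (x ** (phi x)^-1)^-1 ** x^-1^-1.
    by rewrite (autV hphi); group.
  split; first by apply: GJ; exact: gen_inv.
  by apply: residue_conj; [exact: gen_inv|exact: residue_inv].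
- move=> e; rewrite (aut1 hphi) ginv1 gmulr1 -(residue1 hR).
  by split=> [[]|he] //; split => //; exact: gen_one.
Qed.

Lemma kernel_rank_mono r r' : r <= r' -> kernel_rank c r <= kernel_rank c r'.
Proof.
move=> le; apply: Nat.add_le_mono; last nia.
by apply: Nat.mul_le_mono_l; apply: Nat.pow_le_mono_l; lia.
Qed.

(** The residues of the δ(x) now vary with φ. Polynomial distortion of G bounds them: δ(x) is short
    over [gens], hence short over [T], whose residues are at most [A]. *)
Lemma poly_generated_twisted_step :
  poly_distorted G -> poly_generated_twisted G -> poly_generated_twisted H.
Proof.
move=> [T [hT [pT [hpT TG]]]] [r [p [hp hX]]].
have [q hR] := residue_relation_exists.
have [a [A ha]] := residue_list_bound (fun x hx => proj1 (hT x) (gen_base hx)).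
(* For n the norm of φ, x has length at most [p n] and φ(x) at most [p n * n]; the last summand
   makes [M] bound |q| as well. *)
pose M n := pT (p n + p n * n) * A + Z.abs_nat q.
exists (kernel_rank c r), (fun n => (4 ^ c + 2 * M n + 1) * p n); split.
  have hM : poly_bounded M.
    apply: poly_bounded_add; last exact: poly_bounded_const.
    apply: poly_bounded_mul; last exact: poly_bounded_const.
    by apply: (poly_bounded_comp hpT); poly_bounded.
  by poly_bounded.
move=> phi hphi; have [X [lX gX wX]] := hX phi hphi.
have hRphi := twisted_residue_relation hphi hR.
pose B := pT (p (autnorm gens phi) + p (autnorm gens phi) * autnorm gens phi) * A.
have hex j : j < length X -> exists e,
    residue (nth j X one ** (phi (nth j X one))^-1) e /\ (Z.abs e <= Z.of_nat B)%Z.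
  move=> lt; have hx := nth_In X one lt; have hw := wX _ hx.
  apply: (residue_word_bound ha); apply: TG; first by apply/gX; exact: gen_base.
  apply: word_leM (hw) _; apply: word_leV; apply: (word_le_aut hphi) hw => s.
  exact: word_le_autnorm.
have [b hb] := finite_choice hex.
have hbR j (lt : j < length X) : G (nth j X one ** (phi (nth j X one))^-1) /\
    residue (nth j X one ** (phi (nth j X one))^-1) (b j).
  by have [h _] := hb j lt; split => //; apply/gX; apply: gen_base; exact: nth_In.
have hbM j (lt : j < length X) : (Z.abs (b j) <= Z.of_nat (M (autnorm gens phi)))%Z.
  by have [_] := hb j lt; rewrite /M /B; lia.
have [Y [Y0 YX lY [pY [_ YT]]]] :=
  kernel_generated gamma_trivial c_pos hRphi hbR hbM ltac:(rewrite /M; lia).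
exists Y; split.
- exact: Nat.le_trans lY (kernel_rank_mono lX).
- move=> x; rewrite (gen_kernel hRphi Y0 YT); last by case=> gx _; apply/gX.
  rewrite residue0; split=> [[]|hx] //; split => //; exact: H_sub.
- by move=> y /YX; apply: word_le_trans.
Qed.

End CyclicStep.

(** Distortion supplies a finite list [T] generating [gamma (S i)]. The refinement consists of the
    subgroups generated by [gamma (S (S i))] and a tail [L] of [T]; dropping the head of [L] is one
    cyclic step, since commutators of [N] with [gamma (S i)] fall into [gamma (S (S i))]. *)
Lemma gamma_step i : poly_distorted (gamma (S i)) /\ poly_generated_twisted (gamma (S i)) ->
  poly_distorted (@gamma N (S (S i))) /\ poly_generated_twisted (@gamma N (S (S i))).
Proof.
move=> hi; have [[T [hT _]] _] := hi.
suff chain L : (forall x, In x L -> gamma (S i) x) ->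
    forall G, (forall x, G x <-> gen (fun x => gamma (S (S i)) x \/ In x L) x) ->
    poly_distorted G /\ poly_generated_twisted G ->
    poly_distorted (@gamma N (S (S i))) /\ poly_generated_twisted (@gamma N (S (S i))).
  have hTi x : In x T -> gamma (S i) x by move=> hx; apply/hT; exact: gen_base.
  apply: (chain T hTi _ _ hi) => x; split=> [/hT|h]; first by apply: gen_sub => y; right.
  by apply: gamma_gen; apply: gen_sub h => y [|/hTi //]; exact: gammaS_sub.
elim: L => [|t L IH] hL G hG.
  have -> // : G = @gamma N (S (S i)).
  apply: boolp.funext => x; apply: boolp.propext; split=> [/hG h|h].
    by apply: gamma_gen; apply: gen_sub h => y [].
  by apply/hG; apply: gen_base; left.
pose H := gen (fun x => gamma (S (S i)) x \/ In x L).
(* An equality of predicates, so that the hypotheses on [G] take the form required by the cyclic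
   step. *)
have eG : G = gen (fun x => H x \/ x = t).
  apply: boolp.funext => x; apply: boolp.propext; split=> [/hG|h].
    by apply: gen_sub => y [h|[->|h]]; [left|right|left] => //; apply: gen_base; auto.
  apply/hG; apply: gen_idem; apply: gen_sub h => y [|->].
    by apply: gen_sub => z [h|h]; [left|right; right].
  by apply: gen_base; right; left.
have H_comm x g : gen (fun x => H x \/ x = t) g -> H (comm x g).
  rewrite -eG => /hG h; apply: gen_base; left; apply: gamma_comm; apply: gamma_gen.
  apply: gen_sub h => y [|[<-|hy]]; first exact: gammaS_sub.
    by apply: hL; left.
  by apply: hL; right.
rewrite eG => [[hD hE]].
have H1 : H one by exact: gen_one.
have HM x y : H x -> H y -> H (x ** y) by exact: gen_mul.
have HV x : H x -> H x^-1 by exact: gen_inv.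
apply: (IH _ H) => //; first by move=> x hx; apply: hL; right.
by split; [exact: (poly_distorted_step H1 HM HV H_comm hD)|
  exact: (poly_generated_twisted_step H1 HM HV H_comm hD hE)].
Qed.

Lemma gamma_poly i : poly_distorted (@gamma N (S i)) /\ poly_generated_twisted (@gamma N (S i)).
Proof.
elim: i => [|i]; last exact: gamma_step.
split; first by exists gens; split => //; exists id; split => //; exact: poly_bounded_id.
exists (length gens), (fun _ => 1); split; first exact: poly_bounded_const.
by move=> phi _; exists gens; split => // x hx; exact: word_le_base.
Qed.

End Descent.

(* ||H||_S <= B  is expressed as: some finite generating set X of H has all
   elements of word length <= B (the minimum over X of max is attained). *)
Theorem mainTheorem5 (N : group) (S : list N) (i : nat) :
  generates S -> torsion_free N -> nilpotent N -> (0 < i)%nat ->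
  exists (k : nat) (C : R), (0 < C)%R /\
    forall phi : N -> N, is_aut phi ->
      exists X : list N,
        generates_subgroup X (twisted_centralizer phi i) /\
        forall h, In h X ->
          (INR (wordlen S h) <= C * (INR (autnorm S phi)) ^ k)%R.
Proof.
move=> hS _ [c hc]; case: i => [|i] i_pos; first lia.
(* The class is enlarged to [1 + c] to make it positive. *)
have hc' x : gamma (2 + c) x -> x = gone N.
  by move=> hx; apply: hc; apply: gamma_antitone hx; lia.
have [_ [r [p [[C [k hp]] hX]]]] := @gamma_poly N S hS (1 + c) hc' ltac:(lia) i.
(* For n at least 1, (n+1)^k is at most 2^k n^k; the added 1 makes the constant positive. *)
exists k, (INR (C * 2 ^ k) + 1)%R; split; first by have := pos_INR (C * 2 ^ k); lra.
(* The estimate n + 1 <= 2n fails at norm 0. There φ kills every generator, so injectivity makes [N]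
   trivial and the empty list generates. *)
move=> phi hphi; case: (Nat.eq_dec (autnorm S phi) 0) => [e0|ne0].
  have triv x : x = gone N.
    elim: (hS x) => {x} [s hs||x y _ -> _ ->|x _ ->]; [|by []|by group|by group].
    have := word_le_autnorm phi hS hs; rewrite e0 => h.
    have [_ [inj _]] := hphi; apply: inj; rewrite (aut1 hphi).
    by inversion h.
  exists nil; split => // x; rewrite (triv x); split=> _; last exact: gen_one.
  rewrite /twisted_centralizer (triv (gmul _ _)); apply: gamma_gen; exact: gen_one.
have [X [_ gX wX]] := hX phi hphi; exists X; split => // h /wX /wordlen_le le.
apply: (@Rle_trans _ (INR (C * 2 ^ k * autnorm S phi ^ k))).
  apply: le_INR; apply: Nat.le_trans le _; apply: Nat.le_trans (hp _) _.
  rewrite -Nat.mul_assoc -Nat.pow_mul_l; apply: Nat.mul_le_mono_l.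
  by apply: Nat.pow_le_mono_l; lia.
rewrite mult_INR pow_INR.
have := pow_le (INR (autnorm S phi)) k (pos_INR _); nra.
Qed.
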